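(* Let $\beta>1$ and $p>0$, and let $\beta'$ be the exponent conjugate to $\beta$. Let $\lambda=\{\lambda_k\}_{k\ge0}$ be a sequence such that $\lambda_k\in(0,1]$ for all $k$ and $\lambda_k<1$ for at most finitely many $k$. For $h>0$ define $$\mu_d(h)=\inf\Big\{\sum_{k=0}^\infty|a_k|^pe^{\beta'k}:\ \|a\|_1=h,\ \|\lambda a\|_{\beta'}\le1\Big\},$$ the infimum being over real sequences $a=\{a_k\}_{k\ge0}$. Then for each $h_0>0$ there exist positive constants $C=C(p,\beta,h_0)$ and $C'=C'(p,\beta,h_0)$ such that $$Ce^{-L_\lambda\beta'}\,\frac{\exp[\beta'h^\beta]}{h^{p\beta/\beta'}}\le\mu_d(h)\le C'\,\frac{\exp[\beta'h^\beta]}{h^{p\beta/\beta'}}\qquad\text{for all }h\ge h_0,$$ where $$L_\lambda=\sum_{k=0}^\infty\big(\lceil\lambda_k^{-\beta}\rceil-1\big).$$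
   Context: For a sequence $a=\{a_k\}_{k\ge0}$, $\|a\|_q=\big(\sum_{k=0}^\infty|a_k|^q\big)^{1/q}$, and $\lambda a=\{\lambda_ka_k\}_{k\ge0}$. The conjugate exponent satisfies $\frac1\beta+\frac1{\beta'}=1$. The constants $C,C'$ depend only on $p,\beta,h_0$ (not on $\lambda$). *)

(* Defs.v *)
From HB Require Import structures.
From mathcomp Require Import all_boot all_order all_algebra.
From mathcomp Require Import all_classical all_reals all_analysis.

Set Implicit Arguments.
Unset Strict Implicit.
Unset Printing Implicit Defensive.

Import Order.TTheory GRing.Theory Num.Theory.
Import numFieldNormedType.Exports.

Local Open Scope classical_set_scope.
Local Open Scope ring_scope.

(* Extended-real valued: +oo when the series diverges. *)
Definition lnorm (R : realType) (q : R) (a : nat -> R) : \bar R :=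
  ((\sum_(0 <= k <oo) (`|a k| `^ q)%:E) `^ q^-1)%E.

(* Sequences of infinite cost contribute +oo to the infimum. *)
Definition mu_d (R : realType) (p beta' : R) (lambda : nat -> R) (h : R)
  : \bar R :=
  ereal_inf
    [set (\sum_(0 <= k <oo) (`|a k| `^ p * expR (beta' * k%:R))%:E)%E
      | a in [set a : nat -> R |
               lnorm 1 a = h%:E /\
               (lnorm beta' (fun k => (lambda k * a k)%R) <= 1)%E]].

(* limn is a genuine limit only when the series converges; here it is a finite
   sum as soon as lambda k = 1 for all but finitely many k (see is_cvg_L_). *)
Definition L_ (R : realType) (beta : R) (lambda : nat -> R) : R :=
  limn (series (fun k => (Num.ceil (lambda k `^ (- beta)))%:~R - 1 : R)).

Lemma lnormE (R : realType) (q : R) (a : nat -> R) : 0 < q ->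
  lnorm q a = Lnorm counting q%:E (EFin \o a).
Proof. by move=> q0; rewrite Lnorm_counting. Qed.

Lemma is_cvg_L_ (R : realType) (beta : R) (lambda : nat -> R) :
  (forall k, 0 < lambda k <= 1) -> finite_set [set k | lambda k < 1] ->
  cvgn (series (fun k => (Num.ceil (lambda k `^ (- beta)))%:~R - 1 : R)).
Proof.
move=> l01 /finite_seqP [s sE].
have [N HN] : exists N, forall k, (N <= k)%N -> lambda k = 1.
  exists (\max_(k <- s) k).+1 => k Nk.
  apply/eqP; rewrite eq_le; have /andP[_ ->] /= := l01 k.
  rewrite leNgt; apply/negP => lk.
  have ks : k \in s by have : [set` s] k by rewrite -sE.
  have := @leq_bigmax_seq _ (s) xpredT id k ks isT.
  by rewrite leqNgt Nk.
set u := series _; apply/cvg_ex; exists (u N).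
apply: cvg_near_cst; exists N => // m /= Nm.
rewrite /u /series /= (big_cat_nat _ Nm) //= [X in _ + X]big_nat_cond
  [X in _ + X]big1 ?addr0 //.
by move=> i /andP[/andP[Ni _] _]; rewrite HN // powR1 ceil1 subrr.
Qed.

(* Main.v *)
Require Import Defs.
From HB Require Import structures.
From mathcomp Require Import all_boot all_order all_algebra.
From mathcomp Require Import all_classical all_reals all_analysis.
From mathcomp Require Import ring.

Import Order.TTheory GRing.Theory Num.Theory.
Import numFieldNormedType.Exports.

Local Open Scope classical_set_scope.
Local Open Scope ring_scope.

(** Upper bound: the constant sequence [h / n] on [k < n], with [n] the least
    natural number above [h `^ beta], is admissible because [lambda <= 1], and
    its cost is a geometric sum.

    Lower bound: let [J] be the cost of an admissible [a]. Each term of the cost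
    is at most [J], so [`|a k|] decays geometrically and the tail beyond [n] is
    [O(J `^ p^-1 * expR (- beta' * n / p))]. By Hoelder (Young) the first [n]
    terms sum to at most [(n + L) `^ beta^-1]; for [n] close to
    [h `^ beta - 1 - L] this falls short of [h] by at least
    [h `^ (1 - beta) / beta], which the tail must supply. When
    [h `^ beta <= 1 + L], the choice [n = 0] suffices, and this is the only
    place where [h0] enters. *)

(** * Conjugate exponents, powers and geometric sums *)

Lemma conj_exponent_gt0 (R : realFieldType) (b c : R) :
  1 < b -> b^-1 + c^-1 = 1 -> 0 < c.
Proof.
move=> b1 bc; have cV : c^-1 = 1 - b^-1 by rewrite -bc; ring.
by rewrite -invr_gt0 cV subr_gt0 invf_lt1// (lt_trans _ b1).
Qed.

Lemma conj_exponent_div (R : realFieldType) (b c : R) :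
  b != 0 -> b^-1 + c^-1 = 1 -> b / c = b - 1.
Proof.
move=> b0 bc; have -> : c^-1 = 1 - b^-1 by rewrite -bc; ring.
by field.
Qed.

Lemma gt0_powRD (R : realType) (x r s : R) :
  0 < x -> x `^ (r + s) = x `^ r * x `^ s.
Proof. by move=> x0; rewrite powRD// (gt_eqF x0) implybT. Qed.

Lemma nneseries_finite_support (R : realType) (u : nat -> R) (n : nat) :
  (forall k, (n <= k)%N -> u k = 0) ->
  (\sum_(0 <= k <oo) (u k)%:E)%E = (\sum_(0 <= k < n) u k)%:E.
Proof.
move=> u0; apply: cvg_lim => //; apply: cvg_near_cst; exists n => // m /= nm.
rewrite (big_cat_nat _ nm) //= [X in (_ + X)%E]big_nat_cond.
rewrite [X in (_ + X)%E]big1 ?adde0 ?sumEFin//.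
by move=> k /andP[/andP[nk _] _]; rewrite u0.
Qed.

Lemma ler_sum_geometric (R : realFieldType) (x : R) (n : nat) : 1 < x ->
  \sum_(0 <= k < n) x ^+ k <= x ^+ n / (x - 1).
Proof.
move=> x1; rewrite ler_pdivlMr ?subr_gt0// mulrC big_mkord -subrX1.
by rewrite lerBlDr lerDl.
Qed.

Lemma ler_sum_geometric_tail (R : realFieldType) (r : R) (n m : nat) :
  0 <= r < 1 -> \sum_(n <= k < m) r ^+ k <= r ^+ n / (1 - r).
Proof.
move=> /andP[r0 r1]; have r1' : 0 < 1 - r by rewrite subr_gt0.
have [mn|nm] := leqP m n.
  by rewrite big_geq// divr_ge0 ?exprn_ge0// ltW.
rewrite ler_pdivlMr// -{1}(add0n n) big_addn.
under eq_bigr do rewrite exprD.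
rewrite -mulr_suml mulrAC [_ * (1 - r)]mulrC big_mkord.
rewrite -opprB mulNr -subrX1 opprB ler_piMl ?exprn_ge0//.
by rewrite gerBl exprn_ge0.
Qed.

(** * Head and tail estimates for the lower bound *)

(* Young's inequality with the weight [h] is arranged so that the bound
   [h `^ beta - 1] produces directly the gain [h `^ (1 - beta) / beta]. *)
Lemma weighted_young_head (R : realType) (beta beta' h : R)
    (lambda a : nat -> R) (n : nat) :
  0 < beta -> 0 < beta' -> beta^-1 + beta'^-1 = 1 -> 0 < h ->
  (forall k, 0 < lambda k) ->
  \sum_(0 <= k < n) `|lambda k * a k| `^ beta' <= 1 ->
  \sum_(0 <= k < n) lambda k `^ (- beta) <= h `^ beta - 1 ->
  \sum_(0 <= k < n) `|a k| <= h - h `^ (1 - beta) / beta.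
Proof.
move=> b0 b'0 hconj h0 l0 ha hl.
have hb : 0 < h `^ beta by rewrite powR_gt0.
have young k : `|a k| <=
    h * (`|lambda k * a k| `^ beta' / beta' +
         lambda k `^ (- beta) / h `^ beta / beta).
  have lk := l0 k.
  (* The factor [(lambda k)^-1 / h] makes the product equal to [|a k| / h]. *)
  have : `|lambda k * a k| * ((lambda k)^-1 / h) <=
      `|lambda k * a k| `^ beta' / beta' + ((lambda k)^-1 / h) `^ beta / beta.
    apply: conjugate_powR => //; last by rewrite addrC.
    by rewrite divr_ge0 ?invr_ge0 ?ltW.
  have -> : ((lambda k)^-1 / h) `^ beta = lambda k `^ (- beta) / h `^ beta.
    rewrite powRM ?invr_ge0 ?ltW// -(powR_inv1 (ltW lk)) -(powR_inv1 (ltW h0)).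
    by rewrite -!powRrM !mulN1r (powRN h).
  move=> hyp.
  rewrite -ler_pdivrMl//; apply: le_trans hyp; rewrite normrM (gtr0_norm lk).
  by rewrite le_eqVlt; apply/predU1P; left; field; rewrite !gt_eqF.
apply: (le_trans (ler_sum _ (fun k _ => young k))).
rewrite -mulr_sumr big_split /= -!mulr_suml.
have -> : h - h `^ (1 - beta) / beta =
          h * (1 / beta' + (h `^ beta - 1) / h `^ beta / beta).
  rewrite (gt0_powRD _ _ _ _ h0) powRN powRr1 ?(ltW h0)// mul1r.
  have -> : beta'^-1 = 1 - beta^-1 by rewrite -hconj; ring.
  by field; rewrite !gt_eqF.
rewrite ler_pM2l// lerD// ler_pM2r ?invr_gt0//.
by rewrite ler_pM2r ?invr_gt0.
Qed.

(** The termwise bound, solved for [|a k|], is geometric with ratio [expR (- (b / p))]. The terms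
    from [n] on must supply [h - s]; summing their bounds and raising to the power [p] isolates
    [J]. *)
Lemma cost_lower_bound (R : realType) (p b h s J : R) (a : nat -> R) (n : nat) :
  0 < p -> 0 < b -> s <= h ->
  (\sum_(0 <= k <oo) `|a k|%:E)%E = h%:E ->
  (forall k, `|a k| `^ p * expR (b * k%:R) <= J) ->
  \sum_(0 <= k < n) `|a k| <= s ->
  ((h - s) * (1 - expR (- (b / p)))) `^ p * expR (b * n%:R) <= J.
Proof.
move=> p0 b0 sh ah aJ head; set r := expR _.
have r01 : 0 <= r < 1 by rewrite expR_ge0 expR_lt1 oppr_lt0 divr_gt0.
have r1 : 0 < 1 - r by case/andP: r01; rewrite subr_gt0.
have J0 : 0 <= J.
  by apply: le_trans (aJ 0%N); rewrite mulr_ge0 ?powR_ge0 ?expR_ge0.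
(* Used twice: for the bound on each term, and at [k = n] to turn [hs] into the claim. *)
have rE k : (J `^ p^-1 * r ^+ k) `^ p = J * expR (- (b * k%:R)).
  rewrite powRM ?powR_ge0 ?exprn_ge0 ?expR_ge0// -powRrM mulVf ?gt_eqF//.
  rewrite powRr1// -expRM_natr -expRM; congr (_ * expR _).
  by field; rewrite gt_eqF.
have tail k : `|a k| <= J `^ p^-1 * r ^+ k.
  rewrite leNgt; apply/negP => /(gt0_ltr_powR p0).
  rewrite rE !nnegrE mulr_ge0 ?powR_ge0 ?exprn_ge0 ?expR_ge0//.
  move=> /(_ isT (normr_ge0 _)).
  by rewrite expRN ltr_pdivrMr ?expR_gt0// ltNge aJ.
(* Every partial sum past [n] is at most [s] plus the geometric tail, so the limit [h] is too. *)
have hs : h - s <= J `^ p^-1 * r ^+ n / (1 - r).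
  rewrite lerBlDl -lee_fin -ah; apply: lime_le.
    by apply: is_cvg_nneseries => k _ _; rewrite lee_fin.
  exists n => // m /= nm; rewrite sumEFin lee_fin (big_cat_nat _ nm) //=.
  rewrite lerD// (le_trans (ler_sum _ (fun k _ => tail k)))// -mulr_sumr -mulrA.
  by rewrite ler_wpM2l ?powR_ge0// ler_sum_geometric_tail.
rewrite -ler_pdivlMr ?expR_gt0// -expRN -rE.
apply: ge0_ler_powR; rewrite ?nnegrE ?(ltW p0)//.
- by apply: mulr_ge0; [rewrite subr_ge0|exact: ltW].
- by rewrite mulr_ge0 ?powR_ge0 ?exprn_ge0 ?expR_ge0.
- by rewrite -ler_pdivlMr.
Qed.

(** * The quantity [L_] and the two norms *)

(** Each summand is at most its ceiling, that is, 1 plus a term of the series [L_]. These terms are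
    nonnegative because [lambda k <= 1], so partial sums stay below the limit. *)
Lemma sum_powRN_le (R : realType) (beta : R) (lambda : nat -> R) (n : nat) :
  0 <= beta -> (forall k, 0 < lambda k <= 1) ->
  finite_set [set k | lambda k < 1] ->
  \sum_(0 <= k < n) lambda k `^ (- beta) <= n%:R + L_ beta lambda.
Proof.
move=> b0 l01 lfin; rewrite -lerBlDl.
set u := fun k => (Num.ceil (lambda k `^ (- beta)))%:~R - 1 : R.
apply: (@le_trans _ _ (series u n)); last first.
  apply: nondecreasing_cvgn_le; last exact: is_cvg_L_.
  apply/nondecreasing_seqP => k; rewrite /series/= big_nat_recr//= lerDl /u.
  rewrite subr_ge0 (le_trans _ (ceil_ge _))// -(powRr0 (lambda k)).
  by rewrite ger_powR// oppr_le0.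
have -> : n%:R = \sum_(0 <= k < n) (1 : R).
  by rewrite big_mkord sumr_const card_ord.
rewrite /series/= lerBlDl -big_split/=; apply: ler_sum => k _.
by rewrite /u addrC subrK ceil_ge.
Qed.

Lemma L_ge0 (R : realType) (beta : R) (lambda : nat -> R) :
  0 <= beta -> (forall k, 0 < lambda k <= 1) ->
  finite_set [set k | lambda k < 1] -> 0 <= L_ beta lambda.
Proof.
move=> b0 l01 lfin; have := sum_powRN_le _ _ _ 0 b0 l01 lfin.
by rewrite big_nil add0r.
Qed.

Lemma lnorm1E (R : realType) (a : nat -> R) :
  lnorm 1 a = (\sum_(0 <= k <oo) `|a k|%:E)%E.
Proof.
rewrite /lnorm invr1 poweRe1; last first.
  by apply: nneseries_ge0 => k _ _; rewrite lee_fin powR_ge0.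
by apply: eq_eseriesr => k _; rewrite powRr1.
Qed.

Lemma lnorm_le1_sum (R : realType) (q : R) (a : nat -> R) (n : nat) :
  0 < q -> (lnorm q a <= 1)%E -> \sum_(0 <= k < n) `|a k| `^ q <= 1.
Proof.
move=> q0; rewrite /lnorm; set S := limn _ => S1.
have u0 k : (0 <= (`|a k| `^ q)%:E)%E by rewrite lee_fin powR_ge0.
have S0 : (0 <= S)%E by apply: nneseries_ge0.
rewrite -lee_fin -sumEFin; apply: (@le_trans _ _ S).
  by apply: nneseries_lim_ge.
(* An infinite sum is excluded, since its power with exponent [q^-1 > 0] is infinite. *)
move: S1 S0; case: S => [x| |]//=; last by rewrite gt_eqF ?invr_gt0// leye_eq.
rewrite !lee_fin => x1 x0.
have -> : x = x `^ q^-1 `^ q by rewrite -powRrM mulVf ?powRr1// lt0r_neq0.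
rewrite -[leRHS](_ : 1 `^ q = 1); last by rewrite powR1.
by apply: ge0_ler_powR; rewrite ?nnegrE ?powR_ge0 ?(ltW q0).
Qed.

(** * The upper bound *)

Lemma mu_d_upper (R : realType) (p beta beta' : R) (lambda : nat -> R) (h : R) :
  1 < beta -> 0 < p -> beta^-1 + beta'^-1 = 1 ->
  (forall k, 0 < lambda k <= 1) -> 0 < h ->
  (mu_d p beta' lambda h <=
    (expR beta' / (expR beta' - 1) *
      (expR (beta' * h `^ beta) / h `^ (p * beta / beta')))%:E)%E.
Proof.
move=> b1 p0 hconj l01 h0.
have b0 : 0 < beta by apply: lt_trans b1.
have b'0 : 0 < beta' by apply: conj_exponent_gt0 hconj.
have b'E : beta / beta' = beta - 1 by rewrite conj_exponent_div// gt_eqF.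
have hb : 0 < h `^ beta by rewrite powR_gt0.
(* [h]^ beta <= n[gives admissibility;]n <= h [^ beta + 1] costs a factor [expR beta']. *)
set n := (Num.truncn (h `^ beta)).+1.
have hn : h `^ beta <= n%:R by rewrite ltW// truncnS_gt.
have nh : n%:R <= h `^ beta + 1 by rewrite -natr1 lerD2r truncn_le ltW.
have n0 : 0 < n%:R :> R by rewrite ltr0n.
have hn0 : 0 < h / n%:R by rewrite divr_gt0.
have hnh : h / n%:R <= h `^ (1 - beta).
  by rewrite (gt0_powRD _ _ _ _ h0) powRN powRr1 ?(ltW h0)// ler_pM2l// lef_pV2.
pose a k := if (k < n)%N then h / n%:R else 0.
have a0 k : (n <= k)%N -> a k = 0 by rewrite /a ltnNge => ->.
have aE k : (k < n)%N -> a k = h / n%:R by rewrite /a => ->.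
apply: ge_ereal_inf; eexists; first exists a => //; [split|].
- rewrite lnorm1E (@nneseries_finite_support _ _ n); last first.
    by move=> k /a0 ->; rewrite normr0.
  rewrite (@eq_big_nat _ _ _ _ _ _ (fun=> h / n%:R)); last first.
    by move=> k /= kn; rewrite aE// gtr0_norm.
  by rewrite big_mkord sumr_const card_ord -(mulr_natr (h / _)) divfK ?gt_eqF.
- rewrite /lnorm (@nneseries_finite_support _ _ n); last first.
    by move=> k /a0 ->; rewrite mulr0 normr0 powR0 ?gt_eqF.
  rewrite poweR_EFin lee_fin -[leRHS](_ : 1 `^ beta'^-1 = 1); last first.
    by rewrite powR1.
  apply: ge0_ler_powR; rewrite ?nnegrE ?invr_ge0 ?(ltW b'0)//.
    by apply: sumr_ge0 => k _; rewrite powR_ge0.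
  apply: (@le_trans _ _ (\sum_(0 <= k < n) (n%:R^-1 : R))); last first.
    by rewrite big_mkord sumr_const card_ord -(mulr_natr _^-1) mulVf ?gt_eqF.
  apply: ler_sum_nat => k /= kn; rewrite aE//.
  have /andP[lk lk1] := l01 k.
  apply: (@le_trans _ _ ((h / n%:R) `^ beta')).
    apply: ge0_ler_powR; rewrite ?nnegrE ?(ltW b'0) ?(ltW hn0)//.
    by rewrite normrM !gtr0_norm// ler_piMl// ltW.
  (* Since [beta' / beta = beta' - 1], one factor [n^-1] splits off; the remaining power has base at
     most 1. *)
  have -> : (h / n%:R) `^ beta' =
      (h `^ beta / n%:R) `^ (beta' / beta) * n%:R^-1.
    rewrite !powRM ?powR_ge0 ?invr_ge0 ?ltW// -powRrM.
    rewrite -!(powR_inv1 (ltW n0)) -!powRrM -mulrA -(gt0_powRD _ _ _ _ n0).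
    have -> : beta' / beta = beta' - 1.
      by rewrite conj_exponent_div ?gt_eqF// addrC.
    congr (_ `^ _ * _ `^ _); last by ring.
    rewrite mulrBr mulr1 -[X in _ = _ - X](divfK (lt0r_neq0 b'0)) b'E; ring.
  rewrite ler_piMl ?invr_ge0 ?(ltW n0)//.
  rewrite -[leRHS](_ : 1 `^ (beta' / beta) = 1); last by rewrite powR1.
  apply: ge0_ler_powR; rewrite ?nnegrE ?divr_ge0 ?powR_ge0//;
    rewrite ?(ltW b0) ?(ltW b'0)//.
  by rewrite ler_pdivrMr// mul1r.
rewrite (@nneseries_finite_support _ _ n); last first.
  by move=> k /a0 ->; rewrite normr0 powR0 ?mul0r ?gt_eqF.
have E1 : 0 < expR beta' - 1 by rewrite subr_gt0 expR_gt1.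
rewrite lee_fin; apply: (@le_trans _ _
    ((h / n%:R) `^ p * \sum_(0 <= k < n) expR beta' ^+ k)).
  rewrite mulr_sumr; apply: ler_sum_nat => k /= kn.
  by rewrite aE// gtr0_norm// expRM_natr.
apply: (@le_trans _ _
    (h `^ (1 - beta) `^ p * (expR beta' ^+ n / (expR beta' - 1)))).
  apply: ler_pM; rewrite ?powR_ge0//.
  - by apply: sumr_ge0 => k _; rewrite exprn_ge0 ?expR_ge0.
  - by apply: ge0_ler_powR; rewrite ?nnegrE ?powR_ge0 ?(ltW p0) ?(ltW hn0).
  - by rewrite ler_sum_geometric// -subr_gt0.
have -> : h `^ (1 - beta) `^ p = (h `^ (p * beta / beta'))^-1.
  rewrite -powRrM -powRN -(mulrA p) b'E; congr (_ `^ _); ring.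
rewrite mulrC [leRHS]mulrA ler_wpM2r ?invr_ge0 ?powR_ge0//.
rewrite mulrAC ler_pM2r ?invr_gt0// -expRD -expRM_natr ler_expR.
by rewrite -{2}(mulr1 beta') -mulrDr addrC ler_pM2l.
Qed.

(** * The lower bound *)

Lemma mu_d_lower (R : realType) (p beta beta' : R) (lambda : nat -> R)
    (h0 h : R) :
  1 < beta -> 0 < p -> beta^-1 + beta'^-1 = 1 ->
  (forall k, 0 < lambda k <= 1) -> finite_set [set k | lambda k < 1] ->
  0 < h0 <= h ->
  (((1 - expR (- (beta' / p))) `^ p *
      Num.min (beta^-1 `^ p * expR (- (2 * beta')))
              (h0 `^ (p * beta) * expR (- beta')) *
      expR (- (L_ beta lambda * beta')) *
      (expR (beta' * h `^ beta) / h `^ (p * beta / beta')))%:E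
    <= mu_d p beta' lambda h)%E.
Proof.
move=> b1 p0 hconj l01 lfin /andP[h00 h0h].
set K := (1 - _) `^ p; set M := Num.min _ _.
have h_gt0 : 0 < h by apply: lt_le_trans h0h.
have b0 : 0 < beta by apply: lt_trans b1.
have b'0 : 0 < beta' by apply: conj_exponent_gt0 hconj.
have b'E : beta / beta' = beta - 1 by rewrite conj_exponent_div// gt_eqF.
have r1 : 0 < 1 - expR (- (beta' / p)).
  by rewrite subr_gt0 expR_lt1 oppr_lt0 divr_gt0.
have K0 : 0 < K by rewrite powR_gt0.
set L := L_ beta lambda.
have L0 : 0 <= L by apply: L_ge0 => //; apply: ltW.
have hpow : (h `^ (p * beta / beta'))^-1 = h `^ (1 - beta) `^ p.
  rewrite -powRrM -powRN -(mulrA p) b'E; congr (_ `^ _); ring.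
apply: le_ereal_inf_tmp => _ [a [a1 ab] <-].
rewrite lnorm1E in a1.
have u0 k : (0 <= (`|a k| `^ p * expR (beta' * k%:R))%:E)%E.
  by rewrite lee_fin mulr_ge0 ?powR_ge0 ?expR_ge0.
have := @nneseries_lim_ge _ _ xpredT 0%N _ (fun k _ _ => u0 k).
(* Cost [+oo] is trivial; [-oo] contradicts the empty partial sum. *)
case: (limn _) => [J| |] leJ; [|by rewrite leey|]; last first.
  by have := leJ 0%N; rewrite big_nil.
have aJ k : `|a k| `^ p * expR (beta' * k%:R) <= J.
  rewrite -lee_fin (le_trans _ (leJ k.+1))// big_nat_recr//= leeDr//.
  by apply: sume_ge0.
have lower n s sh := @cost_lower_bound _ p beta' h s J a n p0 b'0 sh a1 aJ.
rewrite lee_fin hpow.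
pose X := h `^ beta - 1 - L.
have EE : expR (- (L * beta')) * expR (beta' * h `^ beta) =
    expR (beta' * (X + 1)) by rewrite -expRD /X; congr expR; ring.
have -> : K * M * expR (- (L * beta')) *
    (expR (beta' * h `^ beta) * h `^ (1 - beta) `^ p) =
    K * (M * (expR (beta' * (X + 1)) * h `^ (1 - beta) `^ p)).
  by rewrite -EE; ring.
have W0 : 0 <= expR (beta' * (X + 1)) * h `^ (1 - beta) `^ p.
  by rewrite mulr_ge0 ?expR_ge0 ?powR_ge0.
(* For [X <= 0] the head is empty ([n = 0], [s = 0]), and the tail supplies all of [h]. *)
have [X0|X0] := lerP X 0.
  have := lower 0%N 0 (ltW h_gt0); rewrite big_nil => /(_ (lexx _)).
  rewrite subr0 mulr0 expR0 mulr1 powRM ?(ltW h_gt0) ?(ltW r1)// -/K.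
  rewrite [_ * K]mulrC => /(le_trans _); apply.
  rewrite ler_pM2l//.
  apply: (@le_trans _ _ (h0 `^ (p * beta) * expR (- beta') *
      (expR (beta' * (X + 1)) * h `^ (1 - beta) `^ p))).
    by rewrite ler_wpM2r// ge_min lexx orbT.
  have -> : h `^ p = h `^ (p * beta) * 1 * h `^ (1 - beta) `^ p.
    rewrite -powRrM mulr1 -(gt0_powRD _ _ _ _ h_gt0); congr (_ `^ _); ring.
  rewrite mulrA ler_wpM2r ?powR_ge0// -mulrA ler_pM ?powR_ge0//.
  - by apply: ge0_ler_powR; rewrite ?nnegrE ?(ltW h00) ?(ltW h_gt0)//
      ltW// mulr_gt0.
  - by rewrite -expRD expR_le1 mulrDr mulr1 addrCA addNr addr0 pmulr_rle0.
have /andP[nX Xn] := truncn_itv (ltW X0); set n := Num.truncn X in nX Xn.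
have hd0 : 0 <= h `^ (1 - beta) / beta by rewrite divr_ge0 ?powR_ge0// ltW.
have head : \sum_(0 <= k < n) `|a k| <= h - h `^ (1 - beta) / beta.
  apply: (@weighted_young_head _ beta beta' h lambda) => //.
  - by move=> k; case/andP: (l01 k).
  - exact: lnorm_le1_sum.
  - apply: (le_trans (sum_powRN_le _ _ _ n (ltW b0) l01 lfin)).
    by rewrite -lerBrDr.
have := lower n _ _ head; rewrite gerBl hd0 => /(_ isT) /(le_trans _); apply.
rewrite subKr powRM ?(ltW r1)// -/K [X in _ <= X * _]mulrC -mulrA ler_pM2l//.
rewrite powRM ?powR_ge0 ?invr_ge0 ?(ltW b0)//.
apply: (@le_trans _ _ (beta^-1 `^ p * expR (- (2 * beta')) *
      (expR (beta' * (X + 1)) * h `^ (1 - beta) `^ p))).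
  by rewrite ler_wpM2r// ge_min lexx.
(* The factor [expR (- (2 * beta'))] lowers [X + 1] to [X - 1], which is below [n]. *)
have -> : beta^-1 `^ p * expR (- (2 * beta')) *
      (expR (beta' * (X + 1)) * h `^ (1 - beta) `^ p) =
    h `^ (1 - beta) `^ p * beta^-1 `^ p * expR (beta' * (X - 1)).
  have -> : beta' * (X - 1) = - (2 * beta') + beta' * (X + 1) by ring.
  by rewrite expRD; ring.
rewrite ler_wpM2l ?mulr_ge0 ?powR_ge0// ler_expR ler_pM2l// lerBlDr natr1.
exact: ltW.
Qed.

Theorem lemma2 (R : realType) (beta p beta' : R) (hbeta : 1 < beta)
    (hp : 0 < p) (hconj : beta^-1 + beta'^-1 = 1) (h0 : R) (hh0 : 0 < h0) :
  exists C C' : R,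
    [/\ 0 < C, 0 < C' &
      forall lambda : nat -> R,
        (forall k, 0 < lambda k <= 1) ->
        finite_set [set k | lambda k < 1] ->
        forall h : R, h0 <= h ->
          ((C * expR (- (L_ beta lambda * beta')) *
              (expR (beta' * h `^ beta) / h `^ (p * beta / beta')))%:E
             <= mu_d p beta' lambda h)%E /\
          (mu_d p beta' lambda h
             <= (C' * (expR (beta' * h `^ beta) /
                         h `^ (p * beta / beta')))%:E)%E].
Proof.
have b0 : 0 < beta by apply: lt_trans hbeta.
have b'0 : 0 < beta' by apply: conj_exponent_gt0 hconj.
(* Both witnesses are free of [lambda] and [h]. *)
exists ((1 - expR (- (beta' / p))) `^ p *
  Num.min (beta^-1 `^ p * expR (- (2 * beta')))
          (h0 `^ (p * beta) * expR (- beta'))).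
exists (expR beta' / (expR beta' - 1)); split.
- rewrite mulr_gt0 ?powR_gt0 ?subr_gt0 ?expR_lt1 ?oppr_lt0 ?divr_gt0//.
  by rewrite lt_min !mulr_gt0 ?powR_gt0 ?expR_gt0 ?invr_gt0.
- by rewrite divr_gt0 ?expR_gt0 ?subr_gt0 ?expR_gt1.
- move=> lambda l01 lfin h h0h; split; first by apply: mu_d_lower; rewrite ?hh0.
  by apply: mu_d_upper => //; apply: lt_le_trans h0h.
Qed.
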